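(* There exist constants $C, c > 0$ and $n_0$ such that for every integer $n \geq n_0$ there is an (adaptive) query strategy on the vertex set $[n]$ with the following property: for every tournament $T$ on $[n]$, the strategy makes at most $C\, n^{4/3} (\log n)^c$ queries, and at the end it outputs a vertex $v$ which is a $\left(\frac{1}{2}+\frac{2}{17}\right)$-king in every tournament on $[n]$ that orients each queried pair in the same way as $T$. In other words, a $\left(\frac{1}{2}+\frac{2}{17}\right)$-king can be identified using $\tilde O(n^{4/3})$ edge queries.
   Context: A tournament on $[n]=\{1,\dots,n\}$ is an orientation of the complete graph on $[n]$. In the query model, the tournament $T$ is hidden; a query consists of choosing an unordered pair $\{u,v\}$ of distinct vertices and learning whether the arc $uv$ or $vu$ is in $T$; the choice of each query may depend on the answers to previous queries. A vertex $x$ controls a vertex $y$ if there is a directed path of length at most two from $x$ to $y$ (in particular $x$ controls itself). For $\alpha \in [0,1]$, a vertex is an $\alpha$-king if it controls at least $\alpha n$ vertices. The notation $\tilde O$ hides constant and polylogarithmic factors. *)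

(* Defs.v *)
From mathcomp Require Import all_boot all_order all_algebra.
From mathcomp Require Import reals exp.

Set Implicit Arguments.
Unset Strict Implicit.
Unset Printing Implicit Defensive.

Import Order.TTheory GRing.Theory Num.Theory.
Local Open Scope ring_scope.

Record tournament (V : finType) := Tournament {
  arc :> rel V;
  arc_irreflexive : irreflexive arc;
  arc_oriented : forall u v, u != v -> arc u v = ~~ arc v u
}.

(* [p] lists the vertices of the path after its starting point [x], so [size p]
   is the length of the path; [p = [::]] gives that [x] controls itself. *)
Definition controls (V : finType) (T : tournament V) (x y : V) : bool :=
  [exists p : 2.-bseq V, [&& path T x p, uniq (x :: p) & last x p == y]].

Definition king (R : realType) (V : finType) (alpha : R) (T : tournament V)
    (x : V) : Prop :=
  alpha * #|V|%:R <= #|[set y | controls T x y]|%:R.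

(* Deterministic adaptive strategies, as decision trees. The node
   [Query u v neq_uv next] asks for the orientation of the pair {u, v}; the
   strategy continues as [next true] if the arc is uv and as [next false] if it
   is vu. *)
Inductive strategy (V : finType) : Type :=
| Output (x : V)
| Query (u v : V) (neq_uv : u != v) (next : bool -> strategy V).

Fixpoint output (V : finType) (s : strategy V) (T : tournament V) : V :=
  match s with
  | Output x => x
  | Query u v _ next => output (next (T u v)) T
  end.

(* Successive queries against [T], with repetitions: [size (queries s T)] is the
   number of queries made. *)
Fixpoint queries (V : finType) (s : strategy V) (T : tournament V) :
    seq (V * V) :=
  match s with
  | Output _ => [::]
  | Query u v _ next => (u, v) :: queries (next (T u v)) T
  end.

Definition agree_on (V : finType) (E : seq (V * V)) (T T' : tournament V) :
    Prop :=
  {in E, forall e, T' e.1 e.2 = T e.1 e.2}.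

(* Main.v *)
Require Import Defs.
From mathcomp Require Import all_boot all_order all_algebra.
From mathcomp Require Import reals exp.
From mathcomp Require Import boolp zify ring lra.

Set Implicit Arguments.
Unset Strict Implicit.
Unset Printing Implicit Defensive.

Import Order.TTheory GRing.Theory Num.Theory.

(* Put b ~ n^(1/3) / 30. First query a sparse graph with an edge between any
   two sets of b^2 vertices, and write N(D) for the set of vertices with an
   in-neighbour in D along the queried arcs. Any D has a subset D0 of at most
   n / (b + 1) vertices such that every vertex of D has at most b out-
   neighbours outside N(D0); let P(D0) be the set of all vertices with that
   property. There are few choices for D0, so some list S of about n^(2/3)
   vertices represents every P(D0): a P(D0) that contains half of S has more
   than 4n/9 vertices. Query all pairs in S, and let v beat half of S, say D.
   If N(D) is large, output v, which controls N(D). Otherwise the complement B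
   of N(D0) is large, P = P(D0) has more than 4n/9 vertices, and almost all
   arcs between them go from B to P. In B, find b-stars with disjoint sets of
   leaves that cover almost all of B, query all pairs of their centres S', and
   let u beat half of S'. Then u controls about half of B through the leaves,
   and almost all of P because the half of S' has many vertices; P and B are
   almost disjoint. The total is about 4/9 + 13/68 > 21/34 of the vertices. *)

Local Open Scope nat_scope.

(** * Derandomized sampling *)

Lemma double_expn_le x h q : 0 < q -> x <= q * h -> 2 * x ^ q <= (x + h) ^ q.
Proof.
move=> q_gt0 le_x_qh.
(* Bernoulli's inequality (1 + h/x)^k >= 1 + kh/x, cleared of denominators; at k = q the right side
   is at least 2. *)
have bernoulli k : x ^ k * (x + k * h) <= x * (x + h) ^ k.
  elim: k => [|k IHk]; first by rewrite !expn0; lia.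
  rewrite !expnS.
  apply: (@leq_trans ((x + h) * (x ^ k * (x + k * h)))); last first.
    by rewrite (mulnCA x); apply: leq_mul.
  by rewrite mulSn; nia.
have [->|x_gt0] := posnP x; first by rewrite exp0n // muln0.
rewrite -(leq_pmul2l x_gt0); apply: leq_trans (bernoulli q).
by rewrite mulnA [x * 2]mulnC mulnC leq_mul //; lia.
Qed.

(** Each block of [q] factors gains a factor 2 by [double_expn_le], so [j] blocks outweigh the [N]
    terms of a union bound. *)
Lemma ltn_mul_expn N j x h q :
    N < 2 ^ j -> 0 < q -> 0 < x + h -> x <= q * h ->
  N * x ^ (q * j) < (x + h) ^ (q * j).
Proof.
move=> lt_N q_gt0 xh_gt0 le_x.
have [x0|x_gt0] := posnP (x ^ (q * j)).
  by rewrite x0 muln0 expn_gt0 xh_gt0.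
apply: (@leq_trans (2 ^ j * x ^ (q * j))); first by rewrite ltn_pmul2r.
case: j {lt_N x_gt0} => [|j]; first by rewrite muln0.
by rewrite !expnM -expnMn leq_exp2r ?double_expn_le.
Qed.

Lemma exists_le_average (X : finType) (f : X -> nat) :
  0 < #|X| -> exists x, #|X| * f x <= \sum_y f y.
Proof.
case/card_gt0P=> x0 _; case: (arg_minnP f (isT : xpredT x0)) => x _ min_x.
by exists x; rewrite -sum_nat_const; apply: leq_sum => y _; apply: min_x.
Qed.

(* Method of conditional expectations: each point of [S] in turn is chosen so
   that the total weight grows at most by its average factor. *)
Lemma exists_seq_le_average (X I : finType) (w : X -> I -> nat) beta s :
    0 < #|X| -> (forall i, \sum_x w x i <= beta) ->
  exists S : seq X,
    size S = s /\ #|X| ^ s * \sum_i \prod_(x <- S) w x i <= #|I| * beta ^ s.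
Proof.
move=> X_gt0 le_beta; elim: s => [|s [S [sz_S IHS]]].
  exists [::]; split=> //; rewrite !expn0 mul1n muln1 -sum1_card.
  by apply: leq_sum => i _; rewrite big_nil.
have [x le_x] := exists_le_average
  (fun x => \sum_i \prod_(y <- x :: S) w y i) X_gt0.
exists (x :: S); split; first by rewrite /= sz_S.
rewrite expnSr -mulnA; apply: leq_trans (leq_mul (leqnn _) le_x) _.
rewrite exchange_big /= expnSr mulnA.
apply: leq_trans (leq_mul IHS (leqnn beta)).
rewrite -mulnA leq_mul // big_distrl /=; apply: leq_sum => i _.
under eq_bigr do rewrite big_cons.
by rewrite -big_distrl /= mulnC leq_mul.
Qed.

(** Union bound: a sequence has weight 1 at [i] if it misses [F i] and 0 otherwise, and the chosen
    one has total weight below 1. *)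
Lemma exists_hitting_seq (X I : finType) (F : I -> {set X}) h q j :
    0 < #|X| -> 0 < q -> #|X| <= q * h -> #|I| < 2 ^ j ->
    (forall i, h <= #|F i|) ->
  exists S : seq X, size S = q * j /\ forall i, has (mem (F i)) S.
Proof.
move=> X_gt0 q_gt0 le_X lt_I le_F.
have [|S [sz_S le_S]] := @exists_seq_le_average X I
  (fun x i => x \notin F i) (#|X| - h) (q * j) X_gt0.
  move=> i; rewrite -(cardsC (F i)).
  have -> : \sum_(x : X) (x \notin F i) = #|~: F i|.
    rewrite -sum1_card [RHS]big_mkcond; apply: eq_bigr => x _.
    by rewrite !inE; case: ifP.
  by have := le_F i; lia.
exists S; split=> // i; apply/negPn/negP => no_hit.
have le_h : h <= #|X| by apply: leq_trans (le_F i) (max_card _).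
have prod1 : \prod_(x <- S) (x \notin F i) = 1.
  rewrite big_seq big1 // => x Sx; apply/eqP; rewrite eqb1.
  by apply: contra no_hit => Fx; apply/hasP; exists x.
have := le_S; rewrite leqNgt => /negP; apply.
apply: (@leq_trans (#|X| ^ (q * j))); last first.
  by rewrite leq_pmulr // (bigD1 i) //= prod1.
rewrite -[X in _ < X ^ _](subnK le_h); apply: ltn_mul_expn => //.
  by rewrite subnK.
by apply: leq_trans le_X; apply: leq_subr.
Qed.

Lemma exists_sparse_seq (X I : finType) (P : I -> {set X}) j :
    0 < #|X| -> #|I| < 2 ^ j -> (forall i, 9 * #|P i| <= 4 * #|X|) ->
  exists S : seq X,
    size S = 161 * j /\ forall i, 2 * count (mem (P i)) S < 161 * j.
Proof.
move=> X_gt0 lt_I le_P.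
(* The weights 900 and 729 multiply to 810 ^ 2, so a sequence with at least half
   of its terms in [P i] has weight at least [810 ^ size S], while the average
   weight of a point is at most 805. *)
pose w x i := 9 * (if x \in P i then 100 else 81).
have [|S [sz_S le_S]] :=
    @exists_seq_le_average X I w (805 * #|X|) (161 * j) X_gt0.
  move=> i; rewrite -big_distrr /=.
  have -> : \sum_(x : X) (if x \in P i then 100 else 81) =
            81 * #|X| + 19 * #|P i|.
    rewrite -[#|P i|]sum1_card [\sum_(x in _) 1]big_mkcond -sum1_card.
    rewrite !big_distrr -big_split /=.
    by apply: eq_bigr => x _; case: ifP.
  have arith p c : 9 * p <= 4 * c -> 9 * (81 * c + 19 * p) <= 805 * c by lia.
  exact: arith.
exists S; split=> // i; rewrite ltnNge; apply/negP => many.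
have prodE (s : seq X) : \prod_(x <- s) w x i =
    9 ^ size s * ((10 ^ count (mem (P i)) s) ^ 2 *
    (9 ^ (size s - count (mem (P i)) s)) ^ 2).
  elim: s => [|x s IHs]; first by rewrite big_nil.
  rewrite big_cons IHs /=; have le_c := count_size (mem (P i)) s.
  rewrite /w; case: (x \in P i) => /=.
    rewrite add1n subSS !expnS !expn0 !muln1.
    move: (10 ^ _) (9 ^ _) (9 ^ _) => u v z; nia.
  rewrite add0n subSn // !expnS !expn0 !muln1.
  move: (10 ^ _) (9 ^ _) (9 ^ _) => u v z; nia.
have prod_ge : 810 ^ (161 * j) <= \prod_(x <- S) w x i.
  rewrite prodE -!expnM -sz_S (_ : 810 = 9 * (10 * 9)) // 2!expnMn leq_mul //.
  have := count_size (mem (P i)) S; rewrite -sz_S in many.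
  set c := count _ _ in many *; set s := size S in many * => le_c.
  rewrite ![_ * 2]mulnC; have -> : 2 * c = s + (2 * c - s) by lia.
  have {2}-> : s = (2 * c - s) + 2 * (s - c) by lia.
  rewrite !expnD mulnA leq_mul // leq_mul //.
  by case: (2 * c - s) => // k; rewrite leq_exp2r.
have := le_S; rewrite leqNgt => /negP; apply.
rewrite expnMn mulnA mulnC ltn_pmul2l ?expn_gt0 ?X_gt0 //.
apply: (@leq_trans (810 ^ (161 * j))); last first.
  by apply: leq_trans prod_ge _; rewrite (bigD1 i) //= leq_addr.
(* The length 161 comes from 805 = 161 * 5: that many factors 810/805 gain at least 2. *)
exact: (@ltn_mul_expn _ _ 805 5).
Qed.

(** * Digraphs with an arc between any two large sets *)

Definition dominated (V : finType) (out : rel V) (D : {set V}) : {set V} :=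
  [set y | [exists x in D, out x y]].

(** A pseudorandomness condition on the underlying undirected graph. The two sets may overlap, which
    lets it count arcs inside one set. *)
Definition joined (V : finType) (out : rel V) (a : nat) : Prop :=
  forall A B : {set V}, a <= #|A| -> a <= #|B| ->
    exists2 x, x \in A & exists2 y, y \in B & out x y || out y x.

Lemma exists_subset_card (V : finType) (A : {set V}) k :
  k <= #|A| -> exists2 B : {set V}, B \subset A & #|B| = k.
Proof.
elim: k => [|k IHk] lt_k; first by exists set0; rewrite ?sub0set ?cards0.
have [B sBA cardB] := IHk (ltnW lt_k).
have /subsetPn[x Ax Bx] : ~~ (A \subset B).
  by apply: contraL lt_k => /subset_leq_card; rewrite cardB -leqNgt.
exists (x |: B); last by rewrite cardsU1 Bx cardB.
by rewrite subUset sub1set Ax.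
Qed.

Lemma exchange_sum_card (V : finType) (r : rel V) (A C : {set V}) :
  \sum_(x in A) #|[set y in C | r x y]| = \sum_(y in C) #|[set x in A | r x y]|.
Proof.
have cardE (s : rel V) (B D : {set V}) :
    \sum_(x in B) #|[set y in D | s x y]| = \sum_(x in B) \sum_(y in D) s x y.
  apply: eq_bigr => x _; rewrite -sum1_card [LHS]big_mkcond [RHS]big_mkcond.
  by apply: eq_bigr => y _; rewrite inE; case: (y \in D); case: (s x y).
by rewrite cardE (cardE (fun y x => r x y)) exchange_big.
Qed.

Section SparseDigraph.

Variables (V : finType) (out : rel V) (a : nat).
Hypotheses (a_gt0 : 0 < a) (outj : joined out a).

Lemma dominatedP (D : {set V}) y :
  reflect (exists2 x, x \in D & out x y) (y \in dominated out D).
Proof. by rewrite inE; apply: exists_inP. Qed.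

Lemma dominatedS (D E : {set V}) :
  D \subset E -> dominated out D \subset dominated out E.
Proof.
move=> /subsetP sDE; apply/subsetP => y /dominatedP[x Dx xy].
by apply/dominatedP; exists x; first apply: sDE.
Qed.

(** Cut [k] blocks of size [a] out of [A]. Fewer than [a] vertices of [Z] have no neighbour in a
    given block, so each block adds at least [#|Z| - a]. *)
Lemma joined_card_ge (A Z : {set V}) k :
    k * a <= #|A| ->
  k * (#|Z| - a) <= \sum_(z in Z) #|[set x in A | out x z || out z x]|.
Proof.
elim: k A => [|k IHk] A le_k; first by [].
have [|A1 sA1A cardA1] := @exists_subset_card V A a.
  by apply: leq_trans le_k; rewrite mulSn leq_addr.
have cardAD : #|A :\: A1| = #|A| - a.
  by rewrite cardsD (setIidPr sA1A) cardA1.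
have le_kD : k * a <= #|A :\: A1| by rewrite cardAD; lia.
have /= IH := IHk _ le_kD.
have -> : \sum_(z in Z) #|[set x in A | out x z || out z x]| =
   \sum_(z in Z) #|[set x in A1 | out x z || out z x]| +
   \sum_(z in Z) #|[set x in A :\: A1 | out x z || out z x]|.
  rewrite -big_split; apply: eq_bigr => z _ /=.
  rewrite -cardsUI (_ : _ :&: _ = set0) ?cards0 ?addn0; last first.
    by apply/setP => x; rewrite !inE; case: (x \in A1); rewrite ?andbF.
  apply: eq_card => x; rewrite !inE.
  case A1x: (x \in A1); rewrite ?andbF ?orbF //=.
  by rewrite (subsetP sA1A _ A1x).
rewrite mulSn leq_add //.
pose Z0 := [set z in Z | [forall x in A1, ~~ (out x z || out z x)]].
have lt_Z0 : #|Z0| < a.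
  rewrite ltnNge; apply/negP => le_Z0.
  have [|x A1x [z]] := outj _ le_Z0 (A := A1); first by rewrite cardA1.
  by rewrite inE => /andP[_ /forall_inP/(_ x A1x)/negbTE ->].
have -> : #|Z| = #|Z :\: Z0| + #|Z0|.
  rewrite -(cardsID Z0 Z) addnC (setIidPr _) //.
  by apply/subsetP => z; rewrite inE => /andP[].
apply: (@leq_trans #|Z :\: Z0|); first lia.
rewrite -sum1_card big_mkcond [leqRHS]big_mkcond /=.
apply: leq_sum => z _; rewrite !inE; case Zz: (z \in Z); rewrite ?andbF //=.
rewrite andbT; case: ifP => // /forall_inPn[x A1x]; rewrite negbK => xz.
by apply/card_gt0P; exists x; rewrite inE A1x.
Qed.

(** Otherwise [joined_card_ge] with [Z = A] forces an average of at least 3(t + 1) neighbours inside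
    [A], while the out-degrees allow only 2t. *)
Lemma card_low_outdegree (A : {set V}) t :
    (forall x, x \in A -> #|[set y in A | out x y]| <= t) ->
  #|A| < 4 * t.+1 * a.
Proof.
move=> low; rewrite ltnNge; apply/negP => le_A.
have := @joined_card_ge A A _ le_A.
have sum_out : \sum_(x in A) #|[set y in A | out x y]| <= #|A| * t.
  by rewrite -sum_nat_const; apply: leq_sum => x; apply: low.
have sum_in : \sum_(x in A) #|[set y in A | out y x]| <= #|A| * t.
  by rewrite -exchange_sum_card.
have : \sum_(z in A) #|[set x in A | out x z || out z x]|
    <= #|A| * t + #|A| * t.
  apply: leq_trans (leq_add sum_in sum_out); rewrite -big_split.
  apply: leq_sum => z _; rewrite /= -cardsUI.
  apply: leq_trans (leq_addr _ _); apply: subset_leq_card.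
  by apply/subsetP => x; rewrite !inE; case: (x \in A).
nia.
Qed.

(** Arcs between [D] and the undominated part of [P] all point into [D], at most [k] at each vertex;
    [2 * k + 1] blocks would force an average above [k], since [#|D| - a] is at least half of
    [#|D|]. *)
Lemma card_undominated (P D : {set V}) k :
    2 * a <= #|D| ->
    (forall z, z \in D -> #|[set x in P | out x z]| <= k) ->
  #|P :\: dominated out D| < (2 * k).+1 * a.
Proof.
move=> le_D few; rewrite ltnNge; apply/negP => /(@joined_card_ge _ D).
have : \sum_(z in D) #|[set x in P :\: dominated out D | out x z || out z x]|
    <= #|D| * k.
  rewrite -sum_nat_const; apply: leq_sum => z Dz.
  apply: leq_trans (few z Dz); apply: subset_leq_card.
  apply/subsetP => x; rewrite inE => /andP[/setDP[Px ndx]].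
  case/orP=> xz; first by rewrite inE Px.
  by case/dominatedP: ndx; exists z.
nia.
Qed.

(* [D0] greedily collects vertices of [D] with more than [t] out-neighbours
   that are not yet dominated. *)
Lemma exists_small_kernel (D : {set V}) t :
  exists D0 : {set V},
    [/\ D0 \subset D, #|D0| * t.+1 <= #|V| &
        D \subset [set x | #|[set y in ~: dominated out D0 | out x y]| <= t]].
Proof.
pose ok (E : {set V}) := (E \subset D) && (#|E| * t.+1 <= #|dominated out E|).
have ok0 : ok set0 by rewrite /ok sub0set cards0.
case: (arg_maxnP (fun E : {set V} => #|E|) ok0) => E /andP[sED le_E] max_E.
exists E; split=> //; first by apply: leq_trans le_E (max_card _).
apply/subsetP => x Dx; rewrite inE leqNgt; apply/negP => gt_x.
have Ex : x \notin E.
  apply: contraL gt_x => Ex.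
  rewrite -leqNgt (_ : [set y in _ | _] = set0) ?cards0 //.
  apply/setP => y; rewrite [RHS]inE; apply/setIdP => -[]; rewrite inE.
  by move=> /dominatedP ndy xy; case: ndy; exists x.
have /max_E : ok (x |: E).
  rewrite /ok subUset sub1set Dx sED cardsU1 Ex mulnDl mul1n /=.
  apply: leq_trans (leq_add gt_x le_E) _.
  rewrite -cardsUI (_ : _ :&: _ = set0) ?cards0 ?addn0; last first.
    apply/setP => y; rewrite in_set0 in_setI in_set in_setC.
    by case: (y \in dominated out E); rewrite ?andbF.
  apply: subset_leq_card; rewrite subUset; apply/andP; split.
    apply/subsetP => y; rewrite inE => /andP[_ xy].
    by apply/dominatedP; exists x; rewrite ?setU11.
  exact/dominatedS/subsetUr.
by rewrite /= cardsU1 Ex ltnn.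
Qed.

(** Take as many stars as possible. A vertex of [B] outside them has fewer than [c] out-neighbours
    among the non-leaves of [B], or it would be a new centre; [card_low_outdegree] bounds what is
    left. A centre may be a leaf of another star. *)
Lemma exists_star_cover (B : {set V}) c :
    0 < c ->
  exists S : {set V},
    [/\ S \subset B, c * #|S| <= #|V|, #|B| < c * #|S| + #|S| + 4 * c * a &
        forall D : {set V}, D \subset S ->
          c * #|D| <= #|dominated out D :&: B|].
Proof.
move=> c_gt0.
(* Centres and leaves of disjoint stars with [c] leaves each. *)
pose ok (X : {set V} * {set V}) := [&& X.1 \subset B, X.2 \subset B,
  #|X.2| == c * #|X.1| &
  [forall D : {set V},
    (D \subset X.1) ==> (c * #|D| <= #|dominated out D :&: X.2|)]].
have ok0 : ok (set0, set0).
  rewrite /ok !sub0set cards0 muln0 eqxx /=; apply/forallP => D.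
  by apply/implyP; rewrite subset0 => /eqP ->; rewrite cards0 muln0.
case: (arg_maxnP (fun X : {set V} * {set V} => #|X.1|) ok0) => -[S W].
case/and4P => /= sSB sWB /eqP cardW /forall_inP cover max_S.
exists S; split=> //; last 1 first.
- move=> D sDS; apply: leq_trans (cover D sDS) _.
  by apply/subset_leq_card/setIS.
- by rewrite -cardW max_card.
have low x : x \in B :\: W :\: S -> #|[set y in B :\: W | out x y]| < c.
  rewrite in_setD => /andP[Sx /setDP[Bx Wx]]; rewrite ltnNge; apply/negP.
  move=> /exists_subset_card[C sC cardC].
  have dis : W :&: C = set0.
    apply/setP => y; rewrite !inE; apply/andP => -[Wy /(subsetP sC)].
    by rewrite !inE Wy.
  have /max_S : ok (x |: S, W :|: C).
    rewrite /ok /= !subUset sub1set Bx sSB sWB /=.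
    have -> /= : C \subset B.
      apply: subset_trans sC _; apply/subsetP => y.
      by rewrite !inE => /andP[/andP[]].
    have -> /= : #|W :|: C| == c * #|x |: S|.
      by rewrite cardsU dis cards0 subn0 cardC cardW cardsU1 Sx; lia.
    apply/forall_inP => D sD; have := cover (D :\ x); rewrite subDset sD.
    move=> /(_ isT); case Dx: (x \in D); last first.
      have -> : D :\ x = D.
        by apply/setDidPl; rewrite disjoint_sym disjoints1 Dx.
      move=> /leq_trans; apply.
      by apply/subset_leq_card/setIS/subsetUl.
    move=> le_D; rewrite (cardsD1 x) Dx mulnDr muln1 addnC.
    apply: leq_trans (leq_add le_D (leqnn c)) _.
    rewrite -[X in _ + X <= _]cardC.
    rewrite -cardsUI (_ : _ :&: _ :&: C = set0) ?cards0 ?addn0; last first.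
      by rewrite -setIA dis setI0.
    apply: subset_leq_card; rewrite subUset; apply/andP; split.
      by apply: setISS; [apply/dominatedS/subsetDl | apply: subsetUl].
    rewrite subsetI subsetUr andbT; apply/subsetP => y /(subsetP sC).
    by rewrite inE => /andP[_ xy]; apply/dominatedP; exists x.
  by rewrite /= cardsU1 Sx ltnn.
have := @card_low_outdegree (B :\: W :\: S) c.-1; rewrite prednK //.
have cardB : #|B| <= #|W| + #|S| + #|B :\: W :\: S|.
  have sB : B \subset W :|: S :|: (B :\: W :\: S).
    by apply/subsetP => x Bx; rewrite !inE Bx; case: (x \in W); case: (x \in S).
  apply: leq_trans (subset_leq_card sB) _.
  by rewrite cardsU cardsU; lia.
rewrite -cardW => lt_rest; apply: leq_ltn_trans cardB _.
rewrite ltn_add2l; apply: lt_rest => x Ax; rewrite -ltnS prednK //.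
apply: leq_ltn_trans (low x Ax); apply: subset_leq_card.
by apply/subsetP => y; rewrite !inE => /andP[/andP[_ ->]].
Qed.

End SparseDigraph.

Lemma exists_balanced_set (V : finType) (out : rel V) a t (P B : {set V}) :
    0 < a -> joined out a -> 200 <= t -> 30 ^ 3 * (t * a) <= #|V| ->
    (forall x, x \in P -> #|[set y in B | out x y]| <= t) ->
    4 * #|V| < 9 * #|P| -> 13 * #|V| < 34 * #|B| ->
  exists S : {set V}, [/\ 0 < #|S|, t * #|S| <= #|V| &
    forall D : {set V}, D \subset S -> #|S| <= 2 * #|D| ->
      21 * #|V| <= 34 * #|dominated out D|].
Proof.
move=> a_gt0 outj le_t le_ta few lt_P lt_B.
have t_gt0 : 0 < t by lia.
(* [P] may send arcs to a few vertices of [B] that receive many of them; the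
   centres of the stars must avoid these. *)
pose Z := [set z in B | 100 * t < #|[set x in P | out x z]|].
have le_Z : 100 * #|Z| <= #|V|.
  have out_le : \sum_(x in P) #|[set y in B | out x y]| <= #|P| * t.
    by rewrite -sum_nat_const; apply: leq_sum => x; apply: few.
  have in_ge : #|Z| * (100 * t) <= \sum_(z in B) #|[set x in P | out x z]|.
    rewrite -sum_nat_const [leqLHS]big_mkcond [leqRHS]big_mkcond.
    apply: leq_sum => z _; rewrite !inE; case: (z \in B) => //=.
    by case: ifP => // /ltnW.
  have le_P : #|P| <= #|V| := max_card _.
  rewrite -(leq_pmul2r t_gt0) -mulnA mulnCA.
  apply: leq_trans in_ge _; rewrite -exchange_sum_card.
  by apply: leq_trans out_le _; rewrite leq_mul2r le_P orbT.
set B1 := B :\: Z.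
have cardB1 : #|B| <= #|B1| + #|Z|.
  by rewrite -(cardsID Z B) addnC leq_add2l subset_leq_card ?subsetIr.
have [S [sSB1 le_S lt_B1 cover]] := exists_star_cover a_gt0 outj B1 t_gt0.
have overlap : #|P :&: B1| < 4 * t.+1 * a.
  apply: (card_low_outdegree a_gt0 outj) => x /setIP[Px _].
  apply: leq_trans (few x Px); apply: subset_leq_card.
  by apply/subsetP => y; rewrite !inE => /andP[/andP[_ /andP[_ ->]] ->].
have le_a : 200 * a <= t * a by rewrite leq_mul2r le_t orbT.
have le_tS : 200 * #|S| <= t * #|S| by rewrite leq_mul2r le_t orbT.
have assocE : 4 * t * a = 4 * (t * a) by rewrite mulnA.
have S_gt0 : 0 < #|S|.
  by have [S0|//] := posnP #|S|; move: lt_B1; rewrite S0 muln0; lia.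
exists S; split=> //.
move=> D sDS le_D.
have le_tD : t * #|S| <= 2 * (t * #|D|) by rewrite mulnCA leq_mul2l le_D orbT.
(* The stars fill most of [B1], so [t * #|D|] is more than a sixth of [#|V|], well above
   [2 * (t * a)]. *)
have le_aD : 2 * a <= #|D|.
  by rewrite -(leq_pmul2l t_gt0); lia.
have undom : #|P :\: dominated out D| < (2 * (100 * t)).+1 * a.
  apply: (card_undominated a_gt0 outj le_aD) => z Dz.
  have := subsetP sSB1 _ (subsetP sDS _ Dz).
  by rewrite inE inE => /andP[]; case: (z \in B) => //=; rewrite -leqNgt.
have cardDom : #|P :&: dominated out D| + #|dominated out D :&: B1|
    <= #|dominated out D| + #|P :&: B1|.
  rewrite -cardsUI; apply: leq_add; apply: subset_leq_card.
    by rewrite subUset subsetIr subsetIl.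
  by rewrite setISS ?subsetIl ?subsetIr.
have cardP := cardsID (dominated out D) P.
have := cover D sDS.
(* With n = [#|V|], the surplus 4/9 + 13/68 - 21/34 = 11/612 of n pays for half of [Z] (n/200), half
   of [S] (n/400), the undominated part of [P] (about n/135), and the overlap and uncovered rest
   (below n/4000). *)
lia.
Qed.

(** * Small sets, the first queries, and vertices that beat half of a set *)

Lemma card_small_sets (V : finType) m :
  #|[set A : {set V} | #|A| <= m]| <= #|V|.+1 ^ m.
Proof.
have <- : #|{ffun 'I_m -> option V}| = #|V|.+1 ^ m.
  by rewrite card_ffun card_option card_ord.
rewrite -cardsT.
apply: leq_trans (leq_imset_card
  (fun f : {ffun 'I_m -> option V} => [set x | Some x \in codom f]) _).
apply: subset_leq_card; apply/subsetP => A; rewrite inE => le_A.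
(* The code of [A] lists its elements and pads with [None]. *)
apply/imsetP; exists [ffun i : 'I_m => onth (enum A) i]; first by rewrite inE.
apply/setP => x; rewrite inE; apply/idP/codomP => [Ax|[i]].
  have lt_x : index x (enum A) < m.
    by apply: leq_trans le_A; rewrite cardE index_mem mem_enum.
  exists (Ordinal lt_x); rewrite ffunE /=.
  by rewrite onthE (nth_map x) ?index_mem ?nth_index ?mem_enum.
rewrite ffunE => onth_x; have -> : x = nth x (enum A) i.
  by rewrite -(odflt_onth x) -onth_x.
by rewrite -mem_enum mem_nth // -onthTE -onth_x.
Qed.

(** [exists_hitting_seq] applied to the products of two [a]-sets; the diagonal, at most [a] pairs of
    each product, is removed because a loop cannot be queried. *)
Lemma exists_joining_pairs (V : finType) a q j :
    0 < #|V| -> 0 < q -> #|V| ^ 2 <= q * (a * a - a) ->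
    (#|V|.+1 ^ a) ^ 2 < 2 ^ j ->
  exists E : seq (V * V), [/\ size E <= q * j,
    {in E, forall e, e.1 != e.2} &
    forall A B : {set V}, a <= #|A| -> a <= #|B| ->
      exists2 x, x \in A & exists2 y, y \in B & (x, y) \in E].
Proof.
move=> V_gt0 q_gt0 le_V lt_j.
pose I := {A : {set V} | #|A| == a}.
pose F (i : I * I) := [set e in setX (val i.1) (val i.2) | e.1 != e.2].
have le_F i : a * a - a <= #|F i|.
  have /eqP cardA := valP i.1; have /eqP cardB := valP i.2.
  rewrite /F; move: (val i.1) (val i.2) cardA cardB => A B cardA cardB.
  have -> : [set e in setX A B | e.1 != e.2] =
      setX A B :\: [set (x, x) | x in A].
    apply/setP => -[x y]; rewrite in_setD !inE /= [RHS]andbC.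
    case Ax: (x \in A); case: (y \in B) => //=.
    by congr negb; apply/eqP/imsetP => [<-|[z _ [-> ->]] //]; exists x.
  rewrite cardsD cardsX cardA cardB leq_sub2l //.
  apply: leq_trans (subset_leq_card (subsetIr _ _)) _.
  by rewrite -cardA leq_imset_card.
have lt_I : #|{: I * I}| < 2 ^ j.
  rewrite card_prod; apply: leq_ltn_trans lt_j; rewrite leq_mul //;
  rewrite card_sig; apply: leq_trans (card_small_sets V a);
  by rewrite -[leqRHS]cardsE; apply: subset_leq_card; apply/subsetP => A;
    rewrite !inE => /eqP ->.
have VV_gt0 : 0 < #|{: V * V}| by rewrite card_prod muln_gt0 V_gt0.
have [|E [sz_E hit]] := exists_hitting_seq VV_gt0 q_gt0 _ lt_I le_F.
  by rewrite card_prod.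
exists [seq e <- E | e.1 != e.2]; split.
- by rewrite -sz_E size_filter count_size.
- by move=> e; rewrite mem_filter => /andP[].
move=> A B /exists_subset_card[A1 sA1 /eqP cardA1].
move=> /exists_subset_card[B1 sB1 /eqP cardB1].
have /hasP[[x y] Exy] := hit (exist _ A1 cardA1, exist _ B1 cardB1).
rewrite !inE /= => /andP[/andP[Ax By] xy].
exists x; first exact: (subsetP sA1).
by exists y; rewrite ?(subsetP sB1) // mem_filter xy.
Qed.

(** Of any two terms of [S], one equals or beats the other, so the counts average at least half of
    [size S]. Sampled vertices may repeat, hence a sequence. *)
Lemma exists_half_outdegree (V : finType) (T : tournament V) (S : seq V) :
    0 < size S ->
  exists2 v, v \in S & size S <= 2 * count (fun x => (x == v) || T v x) S.
Proof.
move=> S_gt0; pose r v x := (x == v) || T v x.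
have [/hasP[v Sv le_v]|no_v] :=
  boolP (has (fun v => size S <= 2 * count (r v) S) S); first by exists v.
have lt_sum : \sum_(v <- S) (2 * count (r v) S).+1 <= size S * size S.
  rewrite -[X in _ <= X * _](@sum1_size _ S) big_distrl /= !big_seq.
  apply: leq_sum => v Sv.
  rewrite mul1n ltnNge; apply: contra no_v => le_v.
  by apply/hasP; exists v.
have countE v : count (r v) S = \sum_(x <- S) r v x.
  by rewrite -sum1_count big_mkcond; apply: eq_bigr => x _; case: (r v x).
have sum_ge : size S * size S <= 2 * \sum_(v <- S) count (r v) S.
  under eq_bigr do rewrite countE.
  rewrite mul2n -addnn {2}exchange_big -big_split /=.
  rewrite -[X in X * _ <= _](@sum1_size _ S) big_distrl /=.
  apply: leq_sum => v _.
  rewrite mul1n -big_split -sum1_size /=; apply: leq_sum => x _.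
  rewrite /r; case: (eqVneq x v) => [|xv] //=.
  by rewrite (arc_oriented T xv); case: (T v x).
move: lt_sum; under eq_bigr do rewrite -addn1.
rewrite big_split sum1_size -big_distrr /= => lt_sum.
have := leq_trans lt_sum sum_ge.
by rewrite -[leqRHS]addn0 leq_add2l leqn0 => /eqP S0; rewrite S0 in S_gt0.
Qed.

(** * Blocks of queries, control, and representative samples *)

Lemma agree_on_cat (V : finType) (E E' : seq (V * V)) (T T' : tournament V) :
  agree_on (E ++ E') T T' -> agree_on E T T' /\ agree_on E' T T'.
Proof.
by move=> agr; split=> e Ee; apply: agr; rewrite mem_cat Ee ?orbT.
Qed.

Lemma agree_on_swap (V : finType) (E : seq (V * V)) (T T' : tournament V) x y :
  agree_on E T T' -> (x, y) \in E -> (T' x y = T x y) * (T' y x = T y x).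
Proof.
move=> agr Exy; have /= eq_xy := agr _ Exy; split=> //.
case: (eqVneq y x) => [yx|yx]; first by rewrite yx !arc_irreflexive.
by rewrite !(arc_oriented _ yx) eq_xy.
Qed.

(* A block [E] of non-adaptive queries; the continuation may be chosen knowing
   some tournament [T0] that answers them in the same way as [T]. *)
Lemma exists_query_all (V : finType) (x0 : V) (E : seq (V * V))
    (W : tournament V -> seq (V * V) -> V -> Prop) :
    {in E, forall e, e.1 != e.2} ->
    (forall T0, exists s, forall T, agree_on E T0 T ->
      W T (E ++ queries s T) (output s T)) ->
  exists s, forall T, W T (queries s T) (output s T).
Proof.
(* [C] will collect the answers already known, so that the induction on [E] can branch on the next
   one. *)
pose C : tournament V -> Prop := fun=> True.
move=> neqE WE.
suff [s Ws] : exists s, forall T, C T -> W T (queries s T) (output s T).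
  by exists s => T; apply: Ws.
have {WE} : forall T0, C T0 -> exists s, forall T, C T -> agree_on E T0 T ->
    W T (E ++ queries s T) (output s T).
  by move=> T0 _; have [s Ws] := WE T0; exists s => T _; apply: Ws.
elim: E C W neqE => [|[u v] E IHE] C W neqE WE.
  (* If no tournament satisfies [C], the branch is never reached and [x0] is a dummy output. *)
  have [[T0 CT0]|noC] := pselect (exists T0, C T0).
    have [s Ws] := WE T0 CT0; exists s => T CT.
    by apply: Ws => // e; rewrite in_nil.
  by exists (Output x0) => T CT; case: noC; exists T.
have uv : u != v by apply: (neqE (u, v)); rewrite mem_head.
have next b : exists s, forall T, C T /\ T u v = b ->
    W T ((u, v) :: queries s T) (output s T).
  apply: (IHE (fun T => C T /\ T u v = b) (fun T q => W T ((u, v) :: q))).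
    by move=> e Ee; apply: neqE; rewrite in_cons Ee orbT.
  move=> T0 [CT0 T0b]; have [s Ws] := WE T0 CT0.
  exists s => T [CT Tb] agr; apply: Ws => // e.
  by rewrite in_cons => /predU1P[->|/agr //]; rewrite /= T0b.
have [st Wt] := next true; have [sf Wf] := next false.
exists (Query uv (fun b => if b then st else sf)) => T CT /=.
by case Tuv: (T u v); [apply: Wt | apply: Wf].
Qed.

Lemma controls_dominated (V : finType) (out : rel V) (T : tournament V) v
    (D : {set V}) :
    (forall x, x \in D -> (x == v) || T v x) ->
    (forall x y, out x y -> T x y) ->
  dominated out D \subset [set y | controls T v y].
Proof.
move=> vD outT; apply/subsetP => y /dominatedP[x Dx /outT Txy]; rewrite inE.
have neq z w : T z w -> z != w.
  by case: eqVneq => // ->; rewrite arc_irreflexive.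
apply/existsP.
have [->|vy] := eqVneq v y; first by exists [bseq] => /=; rewrite eqxx.
have [xv|xv] := eqVneq x v.
  by exists [bseq y] => /=; rewrite -xv Txy inE eqxx /= xv vy.
have := vD x Dx; rewrite (negbTE xv) /= => Tvx.
exists [bseq x; y] => /=; rewrite Tvx Txy eqxx !inE negb_or eq_sym xv vy.
by rewrite (neq x y).
Qed.

(** If [D] contains half of [S], so does the superset of [D] given by [exists_small_kernel]; [S] is
    sampled so that no such superset of at most 4/9 of the vertices does. The at most [m]-element
    kernels number at most [2 ^ (L * m)]. *)
Lemma exists_representative_seq (V : finType) (out : rel V) t m L :
    0 < #|V| -> #|V|.+1 <= 2 ^ L -> #|V| < m.+1 * t.+1 ->
  exists S : seq V, size S = 161 * (L * m).+1 /\
    forall D : {set V}, size S <= 2 * count (mem D) S ->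
    exists D0 : {set V}, D0 \subset D /\ 4 * #|V| <
      9 * #|[set x | #|[set y in ~: dominated out D0 | out x y]| <= t]|.
Proof.
move=> V_gt0 le_L lt_m.
pose K (D0 : {set V}) :=
  [set x | #|[set y in ~: dominated out D0 | out x y]| <= t].
pose I := {D0 : {set V} | #|D0| <= m}.
(* Sets too large for [exists_sparse_seq] are replaced by [set0]. *)
pose P (i : I) := if 9 * #|K (val i)| <= 4 * #|V| then K (val i) else set0.
have [||S [sz_S few]] := @exists_sparse_seq V I P (L * m).+1 V_gt0.
- rewrite card_sig; apply: leq_ltn_trans (_ : 2 ^ (L * m) < _); last first.
    by rewrite ltn_exp2l.
  rewrite expnM; apply: (@leq_trans (#|V|.+1 ^ m)); last first.
    by case: m {lt_m P I} => // m; rewrite leq_exp2r.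
  by rewrite -cardsE; apply: card_small_sets.
- by move=> i; rewrite /P; case: ifP => // _; rewrite cards0.
exists S; split=> // D many.
have [D0 [sD0 le_D0 sDK]] := exists_small_kernel out D t.
exists D0; split=> //; rewrite ltnNge; apply/negP => le_K.
have le_m : #|D0| <= m.
  rewrite -ltnS -(@ltn_pmul2r t.+1) //; exact: leq_ltn_trans le_D0 lt_m.
have := few (exist _ D0 le_m); rewrite /P /= le_K ltnNge => /negP; apply.
rewrite -sz_S; apply: leq_trans many _; rewrite leq_mul2l /=.
by apply: sub_count => x /=; apply: (subsetP sDK).
Qed.

(** * The strategy in three blocks of queries *)

Definition offdiagonal_pairs (V : finType) (S : seq V) : seq (V * V) :=
  [seq e <- [seq (x, y) | x <- S, y <- S] | e.1 != e.2].

Lemma size_offdiagonal_pairs (V : finType) (S : seq V) :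
  size (offdiagonal_pairs S) <= size S ^ 2.
Proof.
by rewrite size_filter (leq_trans (count_size _ _)) // size_allpairs.
Qed.

Lemma offdiagonal_pairs_neq (V : finType) (S : seq V) :
  {in offdiagonal_pairs S, forall e, e.1 != e.2}.
Proof. by move=> e; rewrite mem_filter => /andP[]. Qed.

Lemma agree_on_offdiagonal (V : finType) (S : seq V) (T T' : tournament V) x y :
    agree_on (offdiagonal_pairs S) T T' -> x \in S -> y \in S -> T' x y = T x y.
Proof.
move=> agr Sx Sy; have [->|xy] := eqVneq x y; first by rewrite !arc_irreflexive.
by apply: (agr (x, y)); rewrite mem_filter xy allpairs_f.
Qed.

(** 21/34 is 1/2 + 2/17. The summands bound the joining pairs [E0], the pairs in [S] and the pairs
    in [S']. *)
Lemma exists_king_strategy (V : finType) b L N :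
    200 <= b -> 30 ^ 3 * b ^ 3 <= #|V| -> #|V| <= N * b ^ 3 ->
    #|V|.+1 <= 2 ^ L ->
  exists s : strategy V, forall T : tournament V,
    size (queries s T) <= 2 * N ^ 2 * b ^ 2 * (2 * (b ^ 2 * L)).+1
      + (161 * (L * (N * b ^ 2)).+1) ^ 2 + (N * b ^ 2) ^ 2 /\
    forall T' : tournament V, agree_on (queries s T) T T' ->
      21 * #|V| <= 34 * #|[set y | controls T' (output s T) y]|.
Proof.
move=> le_b le_V V_le le_L.
have b_gt0 : 0 < b by lia.
have V_gt0 : 0 < #|V| by have := expn_gt0 b 3; lia.
have N_gt0 : 0 < N by case: N V_le => // V_le; lia.
have /card_gt0P[x0 _] := V_gt0.
have [|||E0 [sz_E0 neq_E0 hit]] :=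
  @exists_joining_pairs V (b ^ 2)
    (2 * N ^ 2 * b ^ 2) (2 * (b ^ 2 * L)).+1 V_gt0.
- by rewrite !muln_gt0 N_gt0 b_gt0.
- have le_bb : 2 <= b ^ 2 by rewrite -mulnn; nia.
  have le_VV : #|V| ^ 2 <= N ^ 2 * (b ^ 2 * b ^ 2 * b ^ 2).
    apply: (@leq_trans ((N * b ^ 3) ^ 2)); first by rewrite leq_exp2r.
    by rewrite expnMn -expnM -!expnD.
  apply: leq_trans le_VV _; move: (b ^ 2) (N ^ 2) le_bb => B M le_B.
  have le_BB : B * B <= 2 * (B * B - B) by rewrite mulnBr; nia.
  move: (_ - _) le_BB => X le_BB.
  have -> : 2 * M * B * X = M * (2 * X * B) by ring.
  by rewrite leq_mul // leq_mul.
- rewrite -expnM; apply: (@leq_ltn_trans (2 ^ (L * (b ^ 2 * 2)))).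
    by rewrite [leqRHS]expnM leq_exp2r // !muln_gt0 b_gt0.
  by rewrite ltn_exp2l // ltnS mulnA [L * _]mulnC mulnC.
pose bound := 2 * N ^ 2 * b ^ 2 * (2 * (b ^ 2 * L)).+1
      + (161 * (L * (N * b ^ 2)).+1) ^ 2 + (N * b ^ 2) ^ 2.
pose W (T : tournament V) q o := size q <= bound /\
  forall T' : tournament V, agree_on q T T' ->
    21 * #|V| <= 34 * #|[set y | controls T' o y]|.
apply: (exists_query_all x0 neq_E0 (W := W)) => T0.
(* The arcs revealed by [E0]; they belong to every tournament that agrees with [T0] on [E0]. *)
pose out x y := T0 x y && (((x, y) \in E0) || ((y, x) \in E0)).
have outT T : agree_on E0 T0 T -> forall x y, out x y -> T x y.
  move=> agr x y /andP[Txy /orP[]] Exy; by rewrite (agree_on_swap agr Exy).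
have outj : joined out (b ^ 2).
  move=> A B le_A le_B; have [x Ax [y By Exy]] := hit A B le_A le_B.
  exists x => //; exists y => //; have /= xy := neq_E0 _ Exy.
  by rewrite /out Exy orbT !andbT (arc_oriented T0 xy) orNb.
have [|S [sz_S large_kernel]] :=
    @exists_representative_seq V out b (N * b ^ 2) L V_gt0 le_L.
  by apply: leq_ltn_trans V_le _; rewrite mulSn mulnSr -mulnA -expnSr; lia.
have S_gt0 : 0 < size S by rewrite sz_S.
suff [s Ws] : exists s, forall T, agree_on E0 T0 T ->
    W T (E0 ++ queries s T) (output s T).
  by exists s.
pose W1 (T : tournament V) q o := agree_on E0 T0 T -> W T (E0 ++ q) o.
apply: (exists_query_all x0 (@offdiagonal_pairs_neq V S) (W := W1)) => T1.
have [v Sv half_v] := exists_half_outdegree T1 S_gt0.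
pose D := [set x in S | (x == v) || T1 v x].
have [D_many|D_few] := leqP (21 * #|V|) (34 * #|dominated out D|).
  exists (Output v) => T agr1 agr0; split.
    rewrite !size_cat addn0 (leq_trans _ (leq_addr _ _)) // leq_add //.
    by apply: leq_trans (size_offdiagonal_pairs S) _; rewrite sz_S.
  move=> T' /agree_on_cat[agr0' /agree_on_cat[agr1' _]].
  apply: leq_trans D_many _; rewrite leq_mul2l /=; apply: subset_leq_card.
  apply: controls_dominated => [x|]; last first.
    by apply: outT => e Ee; rewrite agr0' ?agr0.
  rewrite inE => /andP[Sx]; rewrite (agree_on_offdiagonal agr1') //.
  by rewrite (agree_on_offdiagonal agr1).
have [|D0 [sD0 lt_P]] := large_kernel D.
  apply: leq_trans half_v _; rewrite leq_mul2l /=; apply: eq_leq.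
  by apply: eq_in_count => x Sx; rewrite /= inE Sx.
set P := [set x | _] in lt_P.
have [|||||S' [S'_gt0 le_S' balanced]] :=
    @exists_balanced_set V out (b ^ 2) b P (~: dominated out D0) _ outj le_b.
- by rewrite expn_gt0 b_gt0.
- by rewrite -expnS.
- by move=> x; rewrite inE.
- by [].
(* [dominated out D0] lies in [dominated out D], which has less than 21/34 of the vertices; more
   than 13/34 remain. *)
- have := cardsC (dominated out D0).
  have := subset_leq_card (dominatedS out sD0).
  by lia.
pose W2 (T : tournament V) q o := agree_on E0 T0 T ->
  agree_on (offdiagonal_pairs S) T1 T -> W T (E0 ++ offdiagonal_pairs S ++ q) o.
suff [s Ws] : exists s, forall T, W2 T (queries s T) (output s T).
  by exists s => T agr1 agr0; apply: Ws.
apply: (exists_query_all x0 (@offdiagonal_pairs_neq V (enum S')) (W := W2)).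
move=> T2; have [|u S'u half_u] := @exists_half_outdegree V T2 (enum S').
  by rewrite -cardE.
exists (Output u) => T agr2 agr0 agr1; split.
  rewrite !size_cat addn0 addnA leq_add // ?leq_add //.
    by apply: leq_trans (size_offdiagonal_pairs S) _; rewrite sz_S.
  apply: leq_trans (size_offdiagonal_pairs _) _; rewrite -cardE leq_exp2r //.
  rewrite -(leq_pmul2l b_gt0); apply: leq_trans le_S' _.
  by rewrite mulnCA -expnS.
move=> T' /agree_on_cat[agr0' /agree_on_cat[agr1' /agree_on_cat[agr2' _]]].
have := balanced [set x in S' | (x == u) || T2 u x].
move=> /(_ _ _)/leq_trans; apply.
- by apply/subsetP => x; rewrite inE => /andP[].
- rewrite [X in X <= _]cardE; apply: leq_trans half_u _; rewrite leq_mul2l /=.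
  rewrite -size_filter -(card_uniqP (filter_uniq _ (enum_uniq _))).
  by apply: eq_leq; apply: eq_card => x; rewrite mem_filter mem_enum inE andbC.
rewrite leq_mul2l /=; apply: subset_leq_card.
apply: controls_dominated => [x|]; last first.
  by apply: outT => e Ee; rewrite agr0' ?agr0.
rewrite inE -mem_enum => /andP[S'x]; rewrite (agree_on_offdiagonal agr2') //.
by rewrite (agree_on_offdiagonal agr2).
Qed.

(** * Choice of parameters and real estimates *)

Lemma exists_cube_root k r n :
  0 < k -> k * r ^ 3 <= n ->
  exists b, [/\ r <= b, k * b ^ 3 <= n & n < k * b.+1 ^ 3].
Proof.
move=> k_gt0 le_n.
have bounded b : k * b ^ 3 <= n -> b <= n.
  apply: leq_trans; case: b => // b.
  by apply: leq_trans (leq_pmull _ k_gt0); rewrite -{1}(expn1 b.+1) leq_pexp2l.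
have [b le_b max_b] := ex_maxnP (ex_intro _ r le_n) bounded.
exists b; split=> //; first exact: max_b.
by rewrite ltnNge; apply/negP => /max_b; rewrite ltnn.
Qed.

Lemma query_bound N b L : 0 < N -> 0 < b -> 0 < L ->
  2 * N ^ 2 * b ^ 2 * (2 * (b ^ 2 * L)).+1
    + (161 * (L * (N * b ^ 2)).+1) ^ 2 + (N * b ^ 2) ^ 2
  <= (323 * (N * b ^ 2 * L)) ^ 2.
Proof.
move=> N_gt0 b_gt0 L_gt0; have : 0 < b ^ 2 by rewrite expn_gt0 b_gt0.
move: (b ^ 2) => B B_gt0; set X := N * B * L.
have X_gt0 : 0 < X by rewrite !muln_gt0 N_gt0 B_gt0.
have le1 : 2 * N ^ 2 * B * (2 * (B * L)).+1 <= 6 * X ^ 2.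
  apply: (@leq_trans (2 * N ^ 2 * B * (3 * (B * L)))).
    by rewrite leq_mul2l; apply/orP; right; nia.
  have -> : 2 * N ^ 2 * B * (3 * (B * L)) = 6 * ((N * B) ^ 2 * L) by ring.
  by rewrite [X ^ 2]expnMn leq_mul2l leq_mul2l -mulnn leq_pmull ?orbT.
have le2 : (161 * (L * (N * B)).+1) ^ 2 <= (322 * X) ^ 2.
  rewrite leq_exp2r //; have -> : L * (N * B) = X by rewrite /X mulnC.
  lia.
have le3 : (N * B) ^ 2 <= X ^ 2 by rewrite leq_exp2r // /X leq_pmulr.
(* 6 + 322^2 + 1 <= 323^2. *)
move: le1 le2 le3; rewrite !(expnMn _ X).
rewrite -!mulnn; lia.
Qed.

Local Open Scope ring_scope.

Lemma exprn4_le_powR (R : realType) (b n : nat) :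
  (b ^ 3 <= n)%N -> (b%:R : R) ^+ 4 <= n%:R `^ (4 / 3).
Proof.
move=> le_n.
have -> : (b%:R : R) ^+ 4 = (b ^ 3)%:R `^ (4 / 3).
  rewrite natrX -[LHS]powR_mulrn ?ler0n // -[in RHS]powR_mulrn ?ler0n //.
  rewrite -powRrM.
  by congr (_ `^ _); field.
by rewrite ge0_ler_powR ?nnegrE ?ler0n ?ler_nat //; lra.
Qed.

Lemma trunc_log2_le_ln (R : realType) (n : nat) :
  (1 < n)%N -> ((trunc_log 2 n).+1%:R : R) <= 2 / ln 2 * ln n%:R.
Proof.
move=> lt1n; have ln2_gt0 : 0 < ln (2 : R) by rewrite ln_gt0 // ltr1n.
have le_ln2 k : (2 ^ k <= n)%N -> k%:R * ln 2 <= ln (n%:R : R).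
  move=> le_n; rewrite mulr_natl -lnXn // ler_ln ?posrE ?exprn_gt0 //.
    by rewrite -natrX ler_nat.
  by rewrite ltr0n; lia.
have := le_ln2 1%N lt1n.
have := le_ln2 _ (trunc_logP (isT : (1 < 2)%N) (ltnW lt1n)).
rewrite -natr1 mulrAC ler_pdivlMr //; lra.
Qed.

Theorem theorem22 (R : realType) :
  exists (C c : R) (n0 : nat),
    [/\ 0 < C, 0 < c &
      forall n : nat, (n0 <= n)%N ->
        exists s : strategy 'I_n,
          forall T : tournament 'I_n,
            (size (queries s T))%:R
              <= C * n%:R `^ (4 / 3) * (ln n%:R) `^ c
            /\ forall T' : tournament 'I_n,
                 agree_on (queries s T) T T' ->
                 king (1 / 2 + 2 / 17 : R) T' (output s T)].
Proof.
(* [k] and [r] are kept abstract, since [30 ^ 3 * 200 ^ 3] is a unary number. *)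
have [k def_k] : exists k, k = (30 ^ 3)%N by exists (30 ^ 3)%N.
have [r def_r] : exists r, r = 200%N by exists 200%N.
have k_gt0 : (0 < k)%N by rewrite def_k expn_gt0.
have ln2_gt0 : 0 < ln (2 : R) by rewrite ln_gt0 // ltr1n.
(* n < k (b + 1)^3 <= k (2b)^3 = 8k b^3. *)
pose N := (8 * k)%N.
have N_gt0 : (0 < N)%N by rewrite muln_gt0.
(* [query_bound] gives (323 N b^2 L)^2, where b^4 <= n^(4/3) and L <= (2 / ln 2) ln n; the threshold
   k r^3 ensures b >= r = 200. *)
exists ((323 * N)%N%:R ^+ 2 * (2 / ln 2) ^+ 2), 2, (k * r ^ 3)%N; split=> //.
  by rewrite mulr_gt0 // exprn_gt0 // ?divr_gt0 // ltr0n muln_gt0.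
move=> n /(exists_cube_root k_gt0)[b [le_b le_n lt_n]].
have b_gt0 : (0 < b)%N by rewrite (leq_trans _ le_b) // def_r.
have le_b3 : (b ^ 3 <= n)%N by rewrite (leq_trans _ le_n) // leq_pmull.
have lt1n : (1 < n)%N.
  apply: leq_trans le_b3; rewrite -[X in (X < _)%N](exp1n 3) ltn_exp2r //.
  by rewrite (leq_trans _ le_b) // def_r.
pose L := (trunc_log 2 n).+1.
have [||||s s_ok] := @exists_king_strategy 'I_n b L N.
- by rewrite -def_r.
- by rewrite card_ord -def_k.
- rewrite card_ord; apply: leq_trans (ltnW lt_n) _.
  rewrite /N -mulnA mulnCA leq_mul2l (_ : 8 = 2 ^ 3)%N // -expnMn leq_exp2r //.
  by apply/orP; right; lia.
- by rewrite card_ord trunc_log_ltn.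
exists s => T; have [le_size king_s] := s_ok T; split.
  apply: (@le_trans _ _ ((323 * (N * b ^ 2 * L)) ^ 2)%N%:R).
    by rewrite ler_nat (leq_trans le_size) // query_bound.
  have -> : ((323 * (N * b ^ 2 * L)) ^ 2)%N%:R =
      (323 * N)%N%:R ^+ 2 * (b%:R ^+ 4 * L%:R ^+ 2) :> R.
    by rewrite natrX !natrM; ring.
  rewrite -(mulrA (_ ^+ 2)) -(mulrA (_ ^+ 2)) -(mulrA (_ ^+ 2)).
  rewrite ler_wpM2l ?exprn_ge0 // [leRHS]mulrCA.
  rewrite ler_pM ?exprn_ge0 ?exprn4_le_powR //.
  have ln_ge0n : 0 <= ln (n%:R : R) by rewrite ln_ge0 // ler1n ltnW.
  rewrite powR_mulrn // -exprMn lerXn2r ?nnegrE ?ler0n //.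
    by rewrite mulr_ge0 // divr_ge0 // ltW.
  exact: trunc_log2_le_ln.
move=> T' /king_s; rewrite /king -(ler_nat R) !natrM.
by move: (#|_|%:R) (#|_|%:R) => x y; lra.
Qed.
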